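(* Let $\kappa<\mathfrak c$ be a cardinal and assume $\mathrm{MA}_\kappa(\sigma\text{-linked})$. If $\mathcal A$ and $\mathcal B$ are two almost disjoint families of size $\kappa$, then for every $p\in(1,\infty]$ the Banach spaces $\mathrm{JL}_p(\mathcal A)$ and $\mathrm{JL}_p(\mathcal B)$ are isomorphic.
   Context: An almost disjoint (AD) family on a countable (infinite) set $N$ is a family $\mathcal A$ of infinite subsets of $N$ such that $A\cap B$ is finite for any distinct $A,B\in\mathcal A$. The space $\psi(\mathcal A)=N\cup\mathcal A$ is topologized so that points of $N$ are isolated and the sets $\{A\}\cup(A\setminus F)$, $F\subseteq N$ finite, form a local base at $A\in\mathcal A$; $K_{\mathcal A}=\psi(\mathcal A)\cup\{\infty\}$ is the one-point compactification of this locally compact space. $C(K_{\mathcal A})$ is the Banach space of real-valued continuous functions on $K_{\mathcal A}$ with the supremum norm $\|\cdot\|_\infty$. For $1<p<\infty$ and $f\in C(K_{\mathcal A})$ put $\|f\|_p'=\big(\sum_{A\in\mathcal A}|f(A)|^p\big)^{1/p}$ and $\|f\|_p=\max\{\|f\|_\infty,\|f\|_p'\}$; then $\mathrm{JL}_p(\mathcal A)=\{f\in C(K_{\mathcal A}):\|f\|_p'<\infty\}$ with norm $\|\cdot\|_p$. For $p=\infty$, $\mathrm{JL}_\infty(\mathcal A)=C(K_{\mathcal A})$ with the supremum norm. ''Isomorphic'' means linearly homeomorphic. Let $(\mathbb P,\le)$ be a partially ordered set. $D\subseteq\mathbb P$ is open if $p\in D$, $q\le p$ imply $q\in D$; it is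 dense if for every $p\in\mathbb P$ there is $q\in D$ with $q\le p$. $L\subseteq\mathbb P$ is linked if for any $p_1,p_2\in L$ there is $q\in\mathbb P$ with $q\le p_1,p_2$; $\mathbb P$ is $\sigma$-linked if it is a countable union of linked subsets. A filter is a set $G\subseteq\mathbb P$ that is upwards closed and such that any $p,q\in G$ have some $r\in G$ with $r\le p,q$. For a cardinal $\kappa<\mathfrak c$, $\mathrm{MA}_\kappa(\sigma\text{-linked})$ is the statement: for any $\sigma$-linked poset $\mathbb P$ and any collection $\{D_\alpha:\alpha<\kappa\}$ of dense open subsets of $\mathbb P$ there is a filter $G\subseteq\mathbb P$ such that $D_\alpha\cap G\ne\emptyset$ for every $\alpha<\kappa$. *)

(* Defs.v *)
From HB Require Import structures.
From mathcomp Require Import all_boot all_order all_algebra.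
From mathcomp Require Import all_classical all_reals all_analysis.

Set Implicit Arguments.
Unset Strict Implicit.
Unset Printing Implicit Defensive.

Import Order.TTheory GRing.Theory Num.Theory numFieldNormedType.Exports.

Local Open Scope classical_set_scope.
Local Open Scope ring_scope.

Definition almost_disjoint (N : Type) (A : set (set N)) : Prop :=
  (forall X, A X -> infinite_set X) /\
  (forall X Y, A X -> A Y -> X <> Y -> finite_set (X `&` Y)).

(* [inl n] is the point n of N and [inr X] the point X of the family. *)
Definition psi (N : choiceType) (A : set (set N)) : Type := (N + A)%type.

Section psi_topology.
Context {N : choiceType} {A : set (set N)}.

HB.instance Definition _ := Choice.on (psi A).

Definition psi_nbhs (x : psi A) : set_system (psi A) :=
  match x with
  | inl n => principal_filter (inl n)
  | inr X => filter_from [set F : set N | finite_set F]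
      (fun F => [set inr X] `|` [set inl n | n in \val X `\` F])
  end.

Lemma psi_nbhs_filter (x : psi A) : ProperFilter (psi_nbhs x).
Proof.
case: x => [n|X] /=; first exact: principal_filter_proper.
apply: filter_from_proper => [|F _]; last by exists (inr X); left.
apply: filter_from_filter; first by exists set0; exact: finite_set0.
move=> F G finF finG; exists (F `|` G); first by rewrite /= finite_setU.
move=> _ [->|[n [Xn /not_orP[nF nG]] <-]]; first by split; left.
by split; right; exists n.
Qed.

Lemma psi_nbhs_singleton (x : psi A) U : psi_nbhs x U -> U x.
Proof. by case: x => [n /principal_filterP//|X] [F _]; apply; left. Qed.

Lemma psi_nbhs_nbhs (x : psi A) U :
  psi_nbhs x U -> psi_nbhs x (psi_nbhs^~ U).
Proof.
case: x => [n nU|X [F finF FU]].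
  by apply/principal_filterP.
exists F => //.
move=> _ [->|[n Fn <-]]; first by exists F.
by apply/principal_filterP/FU; right; exists n.
Qed.

HB.instance Definition _ := hasNbhs.Build (psi A) psi_nbhs.

HB.instance Definition _ := @Nbhs_isNbhsTopological.Build (psi A)
  psi_nbhs_filter psi_nbhs_singleton psi_nbhs_nbhs.

End psi_topology.

(* [None] is the point at infinity. *)
Definition K_space (N : choiceType) (A : set (set N)) : Type :=
  one_point_compactification (psi A).

HB.instance Definition _ (N : choiceType) (A : set (set N)) :=
  PointedTopological.copy (K_space A) (one_point_compactification (psi A)).

Section continuous_lmod.
Context {R : realType} {T : topologicalType}.
Implicit Types f g : T -> R^o.

Lemma continuous0 : continuous (0 : T -> R^o).
Proof. exact: (@cst_continuous T R^o 0). Qed.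

Lemma continuousZD a f g : continuous f -> continuous g ->
  continuous (a *: f + g).
Proof.
move=> cf cg x; apply: cvgD; last exact: cg.
by apply: cvgM; [exact: cvg_cst|exact: cf].
Qed.

End continuous_lmod.

Section JL_norm.
Context {R : realType} {N : choiceType} {A : set (set N)}.
Implicit Types f g : K_space A -> R^o.

(* [sup] is the supremum for continuous [f], which is bounded since [K_space A]
   is compact; see [sup_norm_ub]. *)
Definition sup_norm f : R := sup (range (fun x => `|f x|)).

Definition ell_norm (r : R) f : \bar R :=
  ((\esum_(X in [set: A]) (`|f (Some (inr X))| `^ r)%:E) `^ r^-1)%E.

Definition in_JL (p : \bar R) f : Prop :=
  continuous f /\ (if p is r%:E then (ell_norm r f < +oo)%E else True).

Definition JL_norm (p : \bar R) f : R :=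
  if p is r%:E then Num.max (sup_norm f) (fine (ell_norm r f))
  else sup_norm f.

Lemma sup_norm_ub f : continuous f -> has_ubound (range (fun x => `|f x|)).
Proof.
move=> cf; have /compact_bounded [M [_ fM]] : compact (f @` setT).
  apply: continuous_compact; last exact: one_point_compactification_compact.
  exact: continuous_subspaceT.
exists (M + 1) => _ [x _ <-]; apply: (fM (M + 1)); last by exists x.
by rewrite ltrDl.
Qed.

Lemma le_sup_norm f x : continuous f -> `|f x| <= sup_norm f.
Proof. by move=> cf; apply: ub_le_sup; [exact: sup_norm_ub|exists x]. Qed.

Lemma sup_norm_le f a : (forall x, `|f x| <= a) -> sup_norm f <= a.
Proof.
by move=> fa; apply: ge_sup; [exists `|f None|; exists None|move=> _ [x _ <-]].
Qed.

Lemma sup_norm_ge0 f : continuous f -> 0 <= sup_norm f.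
Proof. by move=> cf; exact: le_trans (le_sup_norm None cf). Qed.

Lemma sup_normD f g : continuous f -> continuous g ->
  sup_norm (f + g) <= sup_norm f + sup_norm g.
Proof.
move=> cf cg; apply: sup_norm_le => x.
by rewrite (le_trans (ler_normD _ _))// lerD// le_sup_norm.
Qed.

Lemma sup_normZ f a : continuous f -> sup_norm (a *: f) = `|a| * sup_norm f.
Proof.
move=> cf; apply/eqP; rewrite eq_le; apply/andP; split.
  by apply: sup_norm_le => x; rewrite normrM ler_wpM2l// le_sup_norm.
have [->|a0] := eqVneq a 0.
  by rewrite normr0 mul0r scale0r sup_norm_ge0//; exact: continuous0.
rewrite -ler_pdivlMl ?normr_gt0//; apply: sup_norm_le => x.
rewrite ler_pdivlMl ?normr_gt0// -normrM.
apply: (@le_sup_norm (a *: f) x); rewrite -[a *: f]addr0.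
by apply: continuousZD => //; exact: continuous0.
Qed.

Local Open Scope ereal_scope.

Definition ell_sum (r : R) f : \bar R :=
  \esum_(X in [set: A]) (`|f (Some (inr X))| `^ r)%:E.

Lemma ell_sum_ge0 r f : 0 <= ell_sum r f.
Proof. by apply: esum_ge0 => X _; rewrite lee_fin powR_ge0. Qed.

Lemma ell_norm_ge0 r f : 0 <= ell_norm r f.
Proof. exact: poweR_ge0. Qed.

Lemma ell_norm_fin r f : (ell_norm r f < +oo) = (ell_norm r f \is a fin_num).
Proof. by rewrite ge0_fin_numE ?ell_norm_ge0. Qed.

Lemma ell_norm_leP (r : R) f (a : R) : (0 < r)%R -> (0 <= a)%R ->
  (ell_norm r f <= a%:E) <-> (ell_sum r f <= (a `^ r)%:E).
Proof.
move=> r0 a0; have rN0 : r != 0%R by rewrite gt_eqF.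
split=> h.
  have -> : ell_sum r f = ell_norm r f `^ r.
    by rewrite /ell_norm -poweRrM mulVf// poweRe1// ell_sum_ge0.
  by rewrite -poweR_EFin; apply: gt0_ler_poweR => //;
    rewrite ?ltW// in_itv/= leey andbT ?lee_fin ?ell_norm_ge0.
have -> : a%:E = (a `^ r)%:E `^ r^-1.
  by rewrite poweR_EFin -powRrM mulfV// powRr1.
apply: gt0_ler_poweR => //; first by rewrite invr_ge0 ltW.
  by rewrite in_itv/= leey andbT ell_sum_ge0.
by rewrite in_itv/= leey andbT lee_fin powR_ge0.
Qed.

Lemma esumZl_le (I : choiceType) (c : R) (F : I -> R) :
  (0 <= c)%R -> (forall i, 0 <= F i)%R ->
  \esum_(i in [set: I]) (c * F i)%:E <= c%:E * \esum_(i in [set: I]) (F i)%:E.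
Proof.
move=> c0 F0; apply: ge_ereal_sup => _ [X [finX _] <-].
under eq_fsbigr do rewrite EFinM.
rewrite -ge0_mule_fsumr => [|i]; last by rewrite lee_fin.
by apply: lee_wpmul2l; rewrite ?lee_fin//; apply: ereal_sup_ubound; exists X.
Qed.

Lemma ell_normD_le (r a b : R) f g : (1 < r)%R -> (0 < a)%R -> (0 < b)%R ->
  ell_norm r f <= a%:E -> ell_norm r g <= b%:E ->
  ell_norm r (f + g)%R <= (a + b)%:E.
Proof.
move=> r1 a0 b0; have r0 : (0 < r)%R by rewrite (lt_trans _ r1).
have ab0 : (0 < a + b)%R by rewrite addr_gt0.
move=> /(ell_norm_leP _ r0 (ltW a0)) fa /(ell_norm_leP _ r0 (ltW b0)) gb.
apply/(ell_norm_leP _ r0 (ltW ab0)).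
pose s := (a + b)%R; pose t := (a / s)%R; pose u := (b / s)%R.
have t01 : (0 <= t <= 1)%R.
  by rewrite /t (divr_ge0 (ltW a0) (ltW ab0))/= ler_pdivrMr// mul1r lerDl ltW.
have u0 : (0 <= u)%R by exact: divr_ge0 (ltW b0) (ltW ab0).
have uE : (u = 1 - t)%R.
  by rewrite /u /t -[1%R](@divff _ s) ?gt_eqF// -mulrBl /s addrAC subrr add0r.
have /andP[t0 t1] := t01.
pose c := (s `^ r * (t * (a `^ r)^-1))%R.
pose e := (s `^ r * (u * (b `^ r)^-1))%R.
have c0 : (0 <= c)%R.
  by rewrite mulr_ge0 ?powR_ge0// mulr_ge0// invr_ge0 powR_ge0.
have e0 : (0 <= e)%R.
  by rewrite mulr_ge0 ?powR_ge0// mulr_ge0// invr_ge0 powR_ge0.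
have pw (x y : R) : (`|x + y| `^ r <= c * `|x| `^ r + e * `|y| `^ r)%R.
  have xy : (`|x + y| <= s * (t * (`|x| / a) + u * (`|y| / b)))%R.
    apply: (le_trans (ler_normD _ _)).
    rewrite mulrDr /t /u !mulrA ![(s * _ / s)%R]mulrAC divff ?gt_eqF// !mul1r.
    by rewrite ![(_ * `|_| / _)%R]mulrAC !divff ?gt_eqF// !mul1r.
  have x0 : (0 <= `|x| / a)%R by rewrite divr_ge0// ltW.
  have y0 : (0 <= `|y| / b)%R by rewrite divr_ge0// ltW.
  have w0 : (0 <= t * (`|x| / a) + u * (`|y| / b))%R.
    by rewrite addr_ge0// mulr_ge0.
  apply: (@le_trans _ _ ((s * (t * (`|x| / a) + u * (`|y| / b))) `^ r)%R).
    by rewrite ge0_ler_powR// ?nnegrE ?mulr_ge0// ltW.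
  rewrite powRM ?(ltW ab0)//.
  have cv : ((t * (`|x| / a) + u * (`|y| / b)) `^ r <=
      t * (`|x| / a) `^ r + u * (`|y| / b) `^ r)%R.
    rewrite uE; apply: (convex_powR (ltW r1) (Itv01 t0 t1));
      by rewrite inE/= in_itv/= andbT.
  rewrite (le_trans (ler_wpM2l (powR_ge0 _ _) cv))//.
  rewrite mulrDr /c /e !powRM ?invr_ge0 ?(ltW a0) ?(ltW b0)//.
  rewrite -!powR_inv1 ?powR_ge0 ?(ltW a0) ?(ltW b0)// -!powRrM.
  by rewrite ![(r * -1)%R]mulrC !mulrA ![(_ * `|_| `^ r * _)%R]mulrAC.
apply: (@le_trans _ _ (\esum_(X in [set: A])
    ((c * `|f (Some (inr X))| `^ r)%:E + (e * `|g (Some (inr X))| `^ r)%:E))).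
  by apply: le_esum => X _; rewrite -EFinD lee_fin pw.
rewrite esumD; do 2?[by move=> X _; rewrite lee_fin mulr_ge0 ?powR_ge0].
apply: (@le_trans _ _ (c%:E * ell_sum r f + e%:E * ell_sum r g)).
  by apply: leeD; apply: esumZl_le => // X; exact: powR_ge0.
apply: (@le_trans _ _ (c%:E * (a `^ r)%:E + e%:E * (b `^ r)%:E)).
  by apply: leeD; apply: lee_wpmul2l; rewrite ?lee_fin.
rewrite -!EFinM -EFinD lee_fin /c /e -!mulrA !mulVf ?gt_eqF ?powR_gt0// !mulr1.
by rewrite -mulrDr -mulrDl divff ?gt_eqF// mulr1.
Qed.

Lemma ell_normD (r : R) f g : (1 < r)%R ->
  ell_norm r (f + g)%R <= ell_norm r f + ell_norm r g.
Proof.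
move=> r1; have [ff|] := boolP (ell_norm r f \is a fin_num); last first.
  rewrite ge0_fin_numE ?ell_norm_ge0// -leNgt leye_eq => /eqP ->.
  by rewrite addye ?leey// -ltNye (lt_le_trans _ (ell_norm_ge0 _ _)).
have [fg|] := boolP (ell_norm r g \is a fin_num); last first.
  rewrite ge0_fin_numE ?ell_norm_ge0// -leNgt leye_eq => /eqP ->.
  by rewrite addey ?leey// -ltNye (lt_le_trans _ (ell_norm_ge0 _ _)).
apply/lee_addgt0Pr => d d0.
have pos h : (0 < fine (ell_norm r h) + d / 2)%R.
  by rewrite ltr_wpDl ?divr_gt0// fine_ge0// ell_norm_ge0.
have le h : ell_norm r h \is a fin_num ->
    ell_norm r h <= (fine (ell_norm r h) + d / 2)%:E.
  by move=> fh; rewrite EFinD fineK// leeDl// lee_fin divr_ge0// ltW.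
rewrite (le_trans (ell_normD_le r1 (pos f) (pos g) (le _ ff) (le _ fg)))//.
by rewrite addrACA -splitr !EFinD !fineK.
Qed.

Lemma ell_normZ_le (r : R) f (a : R) : (0 < r)%R ->
  ell_norm r (a *: f)%R <= `|a|%:E * ell_norm r f.
Proof.
move=> r0; rewrite -[X in X%:E * _](@powRr1 _ `|a|%R)// -(@mulfV _ r) ?gt_eqF//.
rewrite powRrM -poweR_EFin -poweRM ?lee_fin ?powR_ge0 ?ell_sum_ge0//.
apply: gt0_ler_poweR; first by rewrite invr_ge0 ltW.
- by rewrite in_itv/= leey andbT ell_sum_ge0.
- by rewrite in_itv/= leey andbT mule_ge0// ?lee_fin ?powR_ge0// ell_sum_ge0.
apply: (@le_trans _ _ (\esum_(X in [set: A])
    (`|a| `^ r * `|f (Some (inr X))| `^ r)%:E)).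
  by apply: le_esum => X _; rewrite lee_fin normrM powRM.
by apply: esumZl_le => [|X]; exact: powR_ge0.
Qed.

Lemma ell_normZ (r : R) f (a : R) : (0 < r)%R -> ell_norm r f < +oo ->
  ell_norm r (a *: f)%R = `|a|%:E * ell_norm r f.
Proof.
move=> r0 fr; apply/eqP; rewrite eq_le ell_normZ_le//=.
have [->|a0] := eqVneq a 0%R; first by rewrite normr0 mul0e ell_norm_ge0.
rewrite -lee_pdivlMl ?normr_gt0// -normfV.
by rewrite (le_trans _ (ell_normZ_le _ _ r0))// scalerA mulVf// scale1r.
Qed.

End JL_norm.

Section JL.
Context {R : realType} {N : choiceType} (A : set (set N)).
Variables (p : \bar R) (p1 : (1 < p)%E).

Definition JL_pred : {pred K_space A -> R^o} := fun f => `[< in_JL p f >].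

Let JL_predP f : reflect (in_JL p f) (f \in JL_pred).
Proof. exact: asboolP. Qed.

Let gt1_gt0 (r : R) : 1 < r -> 0 < r. Proof. exact: lt_trans. Qed.

Lemma JL_submod_closed : submod_closed JL_pred.
Proof.
split=> [|a f g /JL_predP[cf fp] /JL_predP[cg gp]]; apply/JL_predP.
  split; first exact: continuous0.
  case: p p1 => // r; rewrite lte_fin => r1.
  have h : (ell_norm r (0%R : K_space A -> R^o) <= 0%:E)%E.
    apply/ell_norm_leP; rewrite ?gt1_gt0// /ell_sum esum1 ?lee_fin ?powR_ge0//.
    by move=> X _; rewrite normr0 powR0// gt_eqF// gt1_gt0.
  exact: le_lt_trans h (ltry _).
split; first exact: continuousZD.
case: p p1 fp gp => // r; rewrite lte_fin => r1 fr gr.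
rewrite (le_lt_trans (ell_normD _ _ r1))// lte_add_pinfty//.
rewrite (le_lt_trans (ell_normZ_le _ _ (gt1_gt0 r1)))//.
by rewrite lte_mul_pinfty// ?lee_fin.
Qed.

HB.instance Definition _ := GRing.isSubmodClosed.Build R (K_space A -> R^o)
  JL_pred JL_submod_closed.

(* The proof [p1] is a parameter of the type because [JL_norm] is a norm only
   for the admissible exponents. *)
Definition JL & (1 < p)%E : Type := {f : K_space A -> R^o | f \in JL_pred}.

Local Notation JLp := (JL p1).

HB.instance Definition _ := SubType.on JLp.
HB.instance Definition _ := [Choice of JLp by <:].
HB.instance Definition _ := [SubChoice_isSubLmodule of JLp by <:].

Let JLP (f : JLp) : in_JL p (val f). Proof. exact/JL_predP/(valP f). Qed.

Let nrm (f : JLp) : R := JL_norm p (val f).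

Lemma JL_normD (f g : JLp) : nrm (f + g) <= nrm f + nrm g.
Proof.
rewrite /nrm /JL_norm; have [cf] := JLP f; have [cg] := JLP g.
have sD := sup_normD cf cg.
case: p p1 => [r r1 gr fr|//|//]; rewrite ge_max; apply/andP; split.
  by rewrite (le_trans sD)// lerD// le_max lexx.
have D := ell_normD (val f) (val g) r1.
have fgr : (ell_norm r (val f + val g)%R < +oo)%E.
  by rewrite (le_lt_trans D)// lte_add_pinfty.
apply: (@le_trans _ _ (fine (ell_norm r (val f)) + fine (ell_norm r (val g)))).
  by rewrite -lee_fin EFinD !fineK// -ell_norm_fin.
by rewrite lerD// le_max lexx orbT.
Qed.

Lemma JL_normZ (a : R) (f : JLp) : nrm (a *: f) = `|a| * nrm f.
Proof.
rewrite /nrm /JL_norm; have [cf] := JLP f.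
case: p p1 => [r|_ _|//]; rewrite ?sup_normZ// lte_fin => r1 fr.
rewrite ell_normZ ?gt1_gt0// fineM -?ell_norm_fin//.
by rewrite maxr_pMr// sup_normZ.
Qed.

Lemma JL_norm0_eq0 (f : JLp) : nrm f = 0 -> f = 0.
Proof.
rewrite /nrm /JL_norm; have [cf _] := JLP f => f0.
have {}f0 : sup_norm (val f) <= 0.
  by case: p p1 f0 => [r _|_|//] <-; rewrite ?le_max lexx.
apply/val_inj/funext => x; apply/eqP.
by rewrite -normr_le0 (le_trans (le_sup_norm x cf)).
Qed.

HB.instance Definition _ := Lmodule_isNormed.Build R JLp
  JL_normD JL_normZ JL_norm0_eq0.

End JL.

Definition isomorphic (R : realType) (V W : normedModType R) : Prop :=
  exists (T : {linear V -> W}) (S : W -> V),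
    [/\ cancel T S, cancel S T, continuous T & continuous S].

Section forcing.
Local Open Scope order_scope.
Context {d : Order.disp_t} {P : porderType d}.
Implicit Types D L G : set P.

Definition poset_open D : Prop := forall p q, D p -> q <= p -> D q.

Definition poset_dense D : Prop := forall p, exists2 q, D q & q <= p.

Definition linked L : Prop :=
  forall p1 p2, L p1 -> L p2 -> exists q, q <= p1 /\ q <= p2.

Definition poset_filter G : Prop :=
  (forall p q, G p -> p <= q -> G q) /\
  (forall p q, G p -> G q -> exists r, [/\ G r, r <= p & r <= q]).

End forcing.

Definition sigma_linked (d : Order.disp_t) (P : porderType d) : Prop :=
  exists L : nat -> set P,
    (forall n, linked (L n)) /\ \bigcup_n L n = [set: P].

(* Cardinals are represented by types. Posets are nonempty: the empty set is
   dense and open in the empty poset and meets no filter. *)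
Definition MA_sigma_linked (kappa : Type) : Prop :=
  forall (d : Order.disp_t) (P : porderType d),
    [set: P] !=set0 -> sigma_linked P ->
    forall D : kappa -> set P,
      (forall a, poset_dense (D a) /\ poset_open (D a)) ->
      exists2 G : set P, poset_filter G & forall a, D a `&` G !=set0.

(* Main.v *)
(** Restricting functions to the points of A and infinity presents JL_p(A) as an
extension of a space depending only on kappa and p by c_0(N).  It suffices to
find bounded operators V : C(K_B) -> C(K_A) and U : C(K_A) -> C(K_B) which
preserve these restrictions (after identifying A and B with kappa), because then
(f, u) |-> (U f + u, f - V (U f + u)) is an isomorphism from
JL_p(A) + c_0(M) onto JL_p(B) + c_0(N), and the summands c_0 are absorbed by
means of a convergent sequence in K_A, respectively K_B.  As the restrictions
are preserved, one construction serves all exponents p.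

The operator V is given by finite lists nu n of points of M, with
(V f)(n) = f(oo) + sum_(m in nu n) (f(m) - f(oo)).  It works if the lists have
bounded length, every m lies in finitely many of them, and for all but finitely
many n the number of points of nu n in B_xi is 1 or 0 according to whether
n lies in A_xi.  If kappa is infinite, a generic filter for finite approximations
provides such lists, of length at most 2; if kappa is finite, lists of length at
most kappa can be written down. *)

Require Import Defs.
From HB Require Import structures.
(* finmap comes first: its [pickle] would otherwise hide that of [choice]. *)
From mathcomp Require Import finmap.
From mathcomp Require Import all_boot all_order all_algebra.
From mathcomp Require Import all_classical all_reals all_analysis.
From mathcomp Require Import lra.

Set Implicit Arguments.
Unset Strict Implicit.
Unset Printing Implicit Defensive.

Import Order.TTheory GRing.Theory Num.Theory numFieldNormedType.Exports.

Local Open Scope classical_set_scope.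
Local Open Scope card_scope.

(** * Generic rows *)

Section finite_sets.
Local Open Scope nat_scope.

Lemma finite_set_nat_ub (S : set nat) :
  finite_set S -> exists k, forall i, S i -> i < k.
Proof.
case/finite_fsetP => X ->; exists (\max_(i <- X) i).+1 => i /= iX.
by rewrite ltnS (leq_bigmax_seq i).
Qed.

Lemma finite_pickle_lt (T : countType) k :
  finite_set [set x : T | pickle x < k].
Proof.
apply: (@sub_finite_set _ _ (pickle @^-1` `I_k)) => //.
apply: finite_preimage; last exact: finite_II.
by move=> x y _ _; exact: (pcan_inj pickleK).
Qed.

End finite_sets.

Section rows.
Local Open Scope nat_scope.
Context {I : choiceType} {M : countType} {A : I -> set nat} {B : I -> set M}.
Hypotheses
  (A_ad : forall x y, x <> y -> finite_set (A x `&` A y))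
  (B_inf : forall x, infinite_set (B x))
  (B_ad : forall x y, x <> y -> finite_set (B x `&` B y)).

(** For the family A this bounds the indices at which promises can clash; for the family B it gives
    the finitely many points to avoid. *)
Lemma finite_overlaps (T : Type) (C : I -> set T) (F : seq I) x :
  (forall y, x <> y -> finite_set (C x `&` C y)) ->
  finite_set [set n | C x n /\ exists y, [/\ y \in F, x <> y & C y n]].
Proof.
move=> C_ad; apply: (@sub_finite_set _ _
  (\bigcup_(y in [set y | y \in F /\ x <> y]) (C x `&` C y))).
  by move=> n [Cxn [y [yF xy Cyn]]]; exists y.
apply: bigcup_finite => [|y [_ xy]]; last exact: C_ad.
by apply: sub_finite_set (finite_seq F) => y [].
Qed.

Definition separated (F : seq I) k :=
  forall x y i, x \in F -> y \in F -> k <= i -> A x i -> A y i -> x = y.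

Lemma eventually_separated (F : seq I) :
  exists k0, forall k, k0 <= k -> separated F k.
Proof.
have [k0 k0P] : exists k0, forall i, (\bigcup_(x in [set` F])
    [set n | A x n /\ exists y, [/\ y \in F, x <> y & A y n]]) i -> i < k0.
  apply: finite_set_nat_ub; apply: bigcup_finite => [|x _].
    exact: finite_seq.
  by apply: finite_overlaps => y; exact: A_ad.
exists k0 => k k0k x y i xF yF ki Axi Ayi; apply: contrapT => xy.
suff : i < k0 by rewrite ltnNge (leq_trans k0k).
by apply: k0P; exists x => //; split => //; exists y.
Qed.

(** The infinite set [B x] remains nonempty after removal of the points of small code and of its
    overlaps with the other [B y]. *)
Lemma separated_pick (F : seq I) x k : exists m,
  [/\ k <= pickle m, B x m & forall y, y \in F -> B y m -> x = y].
Proof.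
have := infinite_setD (infinite_setD (@B_inf x) (finite_pickle_lt M k))
  (finite_overlaps F (fun y => @B_ad x y)).
move=> /infinite_setN0[m [[Bxm km] nm]]; exists m; split => //.
  by rewrite leqNgt; exact/negP.
by move=> y yF Bym; apply: contrapT => xy; apply: nm; split => //; exists y.
Qed.

(** One separated point is taken for each member of [E]; among the sets indexed by [F] it can lie
    only in its own. *)
Lemma exists_row (F E : seq I) k : uniq E -> exists r : seq M,
  [/\ size r = size E, all (fun m => k <= pickle m) r &
    forall x, x \in F -> count (fun m => m \in B x) r = (x \in E)].
Proof.
move=> uE; have /choice[g gP] := fun x => separated_pick F x k.
exists (map g E); split; first by rewrite size_map.
  by apply/allP => _ /mapP[x _ ->]; have [] := gP x.
move=> x xF; rewrite count_map -count_uniq_mem//; apply: eq_count => y /=.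
have [_ By gy] := gP y.
by apply/idP/eqP => [/set_mem/gy->//|<-]; exact/mem_set.
Qed.

Lemma separated_count (F : seq I) k i : uniq F -> separated F k -> k <= i ->
  count (fun x => i \in A x) F <= 1.
Proof.
move=> uF sepF ki; rewrite -size_filter.
have : {in [seq x <- F | i \in A x] &, forall x y, x = y}.
  move=> x y; rewrite !mem_filter => /andP[/set_mem Ax xF] /andP[/set_mem Ay yF].
  exact: (sepF x y i).
have := filter_uniq (fun x => i \in A x) uF.
case: [seq x <- F | _] => [//|x [//|y s]]/= /andP[+ _] /(_ x y).
by rewrite !inE !eqxx orbT /= => /norP[/eqP xy _] /(_ isT isT)/xy.
Qed.

(* A condition (s, F) fixes the rows of index less than [size s] and promises,
   for the x in F, that later rows have the right number of points in B x.
   Two conditions with the same s are compatible, because a later index lies in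
   at most one A x for x in the first F and one in the second: rows of length 2
   suffice. *)
Definition is_condition (p : seq (seq M) * {fset I}) : bool :=
  `[< (forall i, size (nth [::] p.1 i) <= 2 /\
        all (fun m => i <= pickle m) (nth [::] p.1 i)) /\
      separated p.2 (size p.1) >].

Definition keeps_promise (p q : seq (seq M) * {fset I}) : Prop :=
  forall x i, x \in q.2 -> size q.1 <= i < size p.1 ->
    count (fun m => m \in B x) (nth [::] p.1 i) = (i \in A x).

Definition extends (p q : seq (seq M) * {fset I}) : bool :=
  [&& prefix q.1 p.1, (q.2 `<=` p.2)%fset & `[< keeps_promise p q >]].

Lemma prefix_nth (s t : seq (seq M)) i :
  prefix s t -> i < size s -> nth [::] t i = nth [::] s i.
Proof. by case/prefixP => u -> h; rewrite nth_cat h. Qed.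

Lemma extends_refl : reflexive extends.
Proof.
move=> p; rewrite /extends prefix_refl fsubset_refl; apply/asboolP => x i _.
by move=> /andP[h /(leq_ltn_trans h)]; rewrite ltnn.
Qed.

Lemma extends_anti : antisymmetric extends.
Proof.
move=> [s F] [t G] /andP[/and3P[/= ts GF _] /and3P[/= st FG _]].
congr (_, _); last by apply/eqP; rewrite eqEfsubset FG GF.
by move: ts (size_prefix st) => /prefixP[[|u v] ->];
  rewrite ?cats0// size_cat/= addnS ltnNge leq_addr.
Qed.

Lemma extends_trans : transitive extends.
Proof.
move=> [s F] [t G] [u H]; rewrite /extends/=.
move=> /and3P[st FG /asboolP stP] /and3P[us HF /asboolP usP].
rewrite (prefix_trans us st) (fsubset_trans HF FG); apply/asboolP => x i /= xH.
move=> /andP[ui it]; have [is_|si] := ltnP i (size s).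
  by rewrite (prefix_nth st is_); apply: usP; rewrite //= ui.
by apply: stP; rewrite /= ?si//; exact: (fsubsetP HF).
Qed.

(** Each new row [i] gets one point for every [x] in [F] with [i] in [A x]. The promises of [F] are
    kept up to [k], and from there on [F'] takes over. *)
Lemma exists_extension (s : seq (seq M)) (F F' : {fset I}) k :
  (forall i, size (nth [::] s i) <= 2 /\
    all (fun m => i <= pickle m) (nth [::] s i)) ->
  (forall i, size s <= i -> count (fun x => i \in A x) F <= 2) ->
  size s <= k -> separated F' k ->
  exists t, [/\ is_condition (t, F'), size t = k, prefix s t &
    forall x i, x \in F -> size s <= i < k ->
      count (fun m => m \in B x) (nth [::] t i) = (i \in A x)].
Proof.
move=> sP F2 sk sepF'.
have /choice[g gP] := fun i =>
  exists_row F i (filter_uniq (fun x => i \in A x) (fset_uniq F)).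
pose t := s ++ mkseq (fun j => g (size s + j)) (k - size s).
have st : size t = k by rewrite size_cat size_mkseq subnKC.
have tE i : size s <= i < k -> nth [::] t i = g i.
  move=> /andP[si ik].
  by rewrite nth_cat ltnNge si /= nth_mkseq ?subnKC// ltn_sub2r//
    (leq_ltn_trans si).
exists t; split => //; first last.
- move=> x i xF ik; rewrite tE//; have [_ _ ->//] := gP i.
  by rewrite mem_filter xF andbT.
- exact: prefix_prefix.
apply/asboolP; split; last by rewrite /= st.
move=> i /=; have [ki|ik] := leqP k i; first by rewrite nth_default ?st.
have [is_|si] := ltnP i (size s); first by rewrite nth_cat is_.
rewrite tE ?si//; have [-> ? _] := gP i; split=> //.
by rewrite size_filter F2.
Qed.

(* [B] enters only through the order. *)
Definition condition (A : I -> set nat) (B : I -> set M) : Type :=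
  {p : seq (seq M) * {fset I} | is_condition p}.

HB.instance Definition _ := SubType.on (condition A B).
HB.instance Definition _ := [Choice of condition A B by <:].

Definition condition_le (p q : condition A B) := extends (val p) (val q).

Lemma condition_le_anti : antisymmetric condition_le.
Proof. by move=> p q /extends_anti/val_inj. Qed.

HB.instance Definition _ := Order.Le_isPOrder.Build (Order.Disp tt tt)
  (condition A B) (fun p => extends_refl (val p)) condition_le_anti
  (fun q p r => @extends_trans (val q) (val p) (val r)).

Lemma conditionP (p : condition A B) :
  (forall i, size (nth [::] (val p).1 i) <= 2 /\
    all (fun m => i <= pickle m) (nth [::] (val p).1 i)) /\
  separated (val p).2 (size (val p).1).
Proof. exact/asboolP/(valP p). Qed.

Lemma condition_leE (p q : condition A B) :
  (p <= q)%O = extends (val p) (val q).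
Proof. by []. Qed.

Lemma sigma_linked_condition : sigma_linked (condition A B).
Proof.
(* Each piece fixes the list of rows, and there are only countably many such lists. *)
exists (fun n => [set p | pickle (val p).1 = n]); split; last first.
  by apply/seteqP; split => // p _; exists (pickle (val p).1).
move=> n p q /= <- /(pcan_inj pickleK) qp.
have [rp sepp] := conditionP p; have [rq sepq] := conditionP q.
set s := (val p).1 in qp rp sepp; set F := (val p).2 in sepp.
rewrite qp in sepq rq; set G := (val q).2 in sepq.
(* The union need not be separated at [size s], so the rows are prolonged until it is. *)
have [k0 k0P] := eventually_separated (F `|` G)%fset.
have [||||t [tc st ps tP]] := @exists_extension s (F `|` G)%fset
    (F `|` G)%fset (maxn (size s) k0).
- by [].
- move=> i si; apply: (leq_trans _ (leq_add (separated_count (fset_uniq F) sepp si)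
    (separated_count (fset_uniq G) sepq si))).
  rewrite -count_cat -!size_filter; apply: uniq_leq_size.
    exact/filter_uniq/fset_uniq.
  by move=> x; rewrite !mem_filter mem_cat in_fsetU.
- exact: leq_maxl.
- by apply: k0P; exact: leq_maxr.
exists (exist is_condition _ tc); rewrite !condition_leE /extends/= -/s -/F -/G.
rewrite qp ps fsubsetUl fsubsetUr; split; apply/asboolP => x i /= xF.
  by rewrite -/s st; apply: tP; rewrite in_fsetU xF.
by rewrite qp st; apply: tP; rewrite in_fsetU xF orbT.
Qed.

(** The promises already made are kept while rows are added; once the rows are long enough, [x] can
    join without breaking separation. *)
Lemma dense_condition x c :
  poset_dense [set p : condition A B | x \in (val p).2 /\ c < size (val p).1].
Proof.
move=> p; have [rp sepp] := conditionP p.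
set s := (val p).1 in rp sepp; set F := (val p).2 in sepp.
have [k0 k0P] := eventually_separated (x |` F)%fset.
have [||||t [tc st ps tP]] := @exists_extension s F
    (x |` F)%fset (maxn (size s) (maxn k0 c.+1)).
- by [].
- by move=> i si; rewrite (leq_trans (separated_count (fset_uniq F) sepp si)).
- exact: leq_maxl.
- by apply: k0P; rewrite !leq_max leqnn orbT.
exists (exist is_condition _ tc).
  by rewrite /= fset1U1 st !leq_max leqnn !orbT.
rewrite condition_leE /extends/= -/s -/F ps fsubsetU1.
apply/asboolP => y i /= yF.
by rewrite -/s st; exact: tP.
Qed.

Lemma open_condition x c :
  poset_open [set p : condition A B | x \in (val p).2 /\ c < size (val p).1].
Proof.
move=> p q [xp cp]; rewrite condition_leE.
move=> /and3P[/size_prefix pq /fsubsetP h _].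
by split; [exact: h|exact: leq_trans pq].
Qed.

Lemma condition_nonempty : [set: condition A B] !=set0.
Proof.
suff h : is_condition ([::], fset0) by exists (exist is_condition _ h).
by apply/asboolP; split => [i|x y i]; rewrite ?nth_nil// in_fset0.
Qed.

Lemma MA_rows : MA_sigma_linked I -> infinite_set [set: I] ->
  exists nu : nat -> seq M,
    [/\ forall i, size (nu i) <= 2,
        forall i, all (fun m => i <= pickle m) (nu i) &
        forall x, exists k, forall i, k <= i ->
          count (fun m => m \in B x) (nu i) = (i \in A x)].
Proof.
move=> MA /infiniteP/pcard_geP[c0].
(* With a surjection onto the naturals, the single dense set attached to [x] forces both a promise
   for [x] and a length above [c x]. *)
have [c c_surj] : exists c : I -> nat, forall n, exists x, c x = n.
  by exists c0 => n; have [x _ <-] := @surj _ _ _ _ c0 n Logic.I; exists x.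
have [x|G [_ Gdir] GD] := MA _ (condition A B) condition_nonempty
    sigma_linked_condition
    (fun x => [set p | x \in (val p).2 /\ c x < size (val p).1]).
  by split; [exact: dense_condition|exact: open_condition].
have /choice[p pP] : forall i, exists p, G p /\ i < size (val p).1.
  by move=> i; have [x <-] := c_surj i; have [q [[_ ?] ?]] := GD x; exists q.
exists (fun i => nth [::] (val (p i)).1 i); split => [i|i|x].
- by have [/(_ i)[]] := conditionP (p i).
- by have [/(_ i)[]] := conditionP (p i).
have [q [[xq _] Gq]] := GD x; exists (size (val q).1) => i qi.
(* Row [i] is read off a condition that depends on [i]; a common extension [r] with [q] has the same
   row [i] and keeps the promises of [q]. *)
have [Gp ip] := pP i; have [r [_]] := Gdir _ _ Gp Gq.
rewrite !condition_leE => /and3P[rp _ _] /and3P[rq _ /asboolP rqP].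
rewrite -(prefix_nth rp ip); apply: rqP => //.
by rewrite qi (leq_trans ip)// size_prefix.
Qed.

Lemma finite_rows : finite_set [set: I] ->
  exists C (nu : nat -> seq M),
    [/\ forall i, size (nu i) <= C,
        forall i, all (fun m => i <= pickle m) (nu i) &
        forall x i, count (fun m => m \in B x) (nu i) = (i \in A x)].
Proof.
case/finite_fsetP => F FE; have inF x : x \in F.
  by have : [set` F] x by rewrite -FE.
have /choice[g gP] := fun i =>
  exists_row F i (filter_uniq (fun x => i \in A x) (fset_uniq F)).
exists (size F), g; split => [i|i|x i].
- by have [-> _ _] := gP i; rewrite size_filter count_size.
- by have [_ ->] := gP i.
by have [_ _ ->//] := gP i; rewrite mem_filter inF andbT.
Qed.

End rows.

Lemma MA_transfer (I : Type) (N M : countType) (A : I -> set N)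
    (B : I -> set M) :
  MA_sigma_linked I ->
  (forall x y, x <> y -> finite_set (A x `&` A y)) ->
  (forall x, infinite_set (B x)) ->
  (forall x y, x <> y -> finite_set (B x `&` B y)) ->
  exists C (nu : N -> seq M),
    [/\ forall n, (size (nu n) <= C)%N,
        forall m, finite_set [set n | m \in nu n] &
        forall x, finite_set
          [set n | count (fun m => m \in B x) (nu n) != (n \in A x) :> nat]].
Proof.
move=> MA A_ad B_inf B_ad.
(* [{classic I}] equips the index type with the choice structure required for finite sets of
   indices; points of [N] are replaced by their codes. *)
pose A' (x : {classic I}) : set nat := pickle @` A x.
have A'_ad x y : x <> y -> finite_set (A' x `&` A' y).
  move=> /A_ad/(finite_image (@pickle N)); apply: sub_finite_set.
  move=> _ [[n An <-] [n' A'n /(pcan_inj pickleK) nn']].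
  by exists n => //; split => //; rewrite -nn'.
suff [C [nu [nuC nu_far nuP]]] : exists C (nu : nat -> seq M),
    [/\ forall i, (size (nu i) <= C)%N,
        forall i, all (fun m => i <= pickle m)%N (nu i) &
        forall x : {classic I}, exists k, forall i, (k <= i)%N ->
          count (fun m => m \in B x) (nu i) = (i \in A' x)].
  exists C, (nu \o pickle); split => [n|m|x] /=; first exact: nuC.
    (* A row containing [m] has index at most [pickle m], hence the successor. *)
    apply: sub_finite_set (finite_pickle_lt N (pickle m).+1) => n /= mn.
    by rewrite ltnS; exact: (allP (nu_far (pickle n))).
  have [k kP] := nuP x; apply: sub_finite_set (finite_pickle_lt N k) => n /=.
  apply: contraNT; rewrite -leqNgt => /kP ->; apply/eqP; congr (nat_of_bool _).
  apply/idP/idP => /set_mem; last by move=> An; apply/mem_set; exists n.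
  by case=> n' An' /(pcan_inj pickleK) <-; exact/mem_set.
have [fin|inf] := pselect (finite_set [set: {classic I}]).
  have [C [nu [? ? nuP]]] := finite_rows (A := A') B_inf B_ad fin.
  by exists C, nu; split => // x; exists 0%N => i _; exact: nuP.
by exists 2; exact: (MA_rows A'_ad B_inf B_ad MA inf).
Qed.

Local Open Scope ring_scope.

(** * Continuous functions on K_A *)

Section K_space_points.
Context {N : choiceType} {A : set (set N)}.

Definition Kpoint (n : N) : K_space A := Some (inl n).
Definition Kset (X : A) : K_space A := Some (inr X).
Definition Kinfty : K_space A := None.

(** For finite [H], the complements of these sets serve as the neighbourhoods of infinity. *)
Definition psi_compact (E : seq A) (H : set N) : set (psi A) :=
  [set x | match x with
           | inl n => H n \/ exists2 X, X \in E & val X n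
           | inr X => X \in E
           end].

Definition psi_sequence (X : A) : set (psi A) :=
  [set inr X] `|` [set inl n | n in val X].

(** A filter on the sequence that does not cluster at its limit contains a finite set of isolated
    points. *)
Lemma compact_psi_sequence (X : A) : compact (psi_sequence X).
Proof.
move=> F FF FW; have [clX|] := pselect (cluster F (inr X)).
  by exists (inr X); split => //; left.
move=> /existsNP[S /existsNP[V /not_implyP[FS /not_implyP[[G finG GV] SV]]]].
have FG : F [set inl n | n in val X `&` G].
  apply: filterS (filterI FS FW) => y [Sy [yX|[n Xn ny]]].
    by exfalso; apply: SV; exists y; split => //; apply: GV; left.
  exists n => //; split => //; apply: contrapT => Gn; apply: SV; exists y.
  by split => //; apply: GV; right; exists n.
have : compact ([set inl n | n in val X `&` G] : set (psi A)).
  by apply/finite_compact/finite_image/finite_setIr.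
move=> /(_ F FF FG)[_ [[n [Xn _] <-] cln]].
by exists (inl n); split => //; right; exists n.
Qed.

Lemma compact_psi_compact (E : seq A) (H : set N) :
  finite_set H -> compact (psi_compact E H).
Proof.
move=> finH; elim: E => [|X E IH].
  apply/finite_compact/(sub_finite_set _ (finite_image (@inl N A) finH)).
  by move=> [n|X] //= [Hn|[]]//; exists n.
rewrite (_ : psi_compact _ _ =
  psi_sequence X `|` psi_compact E H).
  exact: (compactU (@compact_psi_sequence X) IH).
apply/seteqP; split=> [[n|Y]|[n|Y]] /=.
- case=> [Hn|[Y]]; first by right; left.
  by rewrite inE => /predU1P[->|YE] Yn;
    [left; right; exists n|right; right; exists Y].
- by rewrite inE => /predU1P[->|]; [left; left|right].
- case=> [[//|[m Xm [<-]]]|[Hn|[Y YE Yn]]]; [|by left|].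
    by right; exists X => //; rewrite mem_head.
  by right; exists Y => //; rewrite inE YE orbT.
- by rewrite inE; case=> [[[<-]|[]//]|->]; rewrite ?eqxx ?orbT.
Qed.

Hypothesis A_ad : almost_disjoint A.

Lemma finite_overlap (X : A) (E : seq A) : finite_set
  [set n | val X n /\ exists Y, [/\ Y \in E, X <> Y & val Y n]].
Proof.
apply: (@sub_finite_set _ _
  (\bigcup_(Y in [set Y | Y \in E /\ X <> Y]) (val X `&` val Y))).
  by move=> n [Xn [Y [YE XY Yn]]]; exists Y.
apply: bigcup_finite => [|Y [_ XY]].
  by apply: sub_finite_set (finite_seq E) => Y [].
by apply: A_ad.2; [exact: set_valP|exact: set_valP|move/val_inj].
Qed.

(** By almost disjointness, a member outside [E] meets those in [E] in finitely many points, which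
    its neighbourhood can omit together with [H]. *)
Lemma closed_psi_compact (E : seq A) (H : set N) :
  finite_set H -> closed (psi_compact E H).
Proof.
move=> finH; rewrite -openC openE => -[n|X] Wx.
  by apply/principal_filterP.
exists (H `|` [set n | val X n /\ exists Y, [/\ Y \in E, X <> Y & val Y n]]).
  by rewrite /= finite_setU; split => //; exact: finite_overlap.
move=> _ [->//|[n [Xn /not_orP[Hn nE]] <-]] [//|[Y YE Yn]].
apply: nE; split => //; exists Y; split => // XY; apply: Wx.
by rewrite /psi_compact/= XY.
Qed.

End K_space_points.

(** * Continuity as approximation by finite combinations of indicators *)

Section approximation.
Context {R : realType} {N : choiceType} {A : set (set N)}.
Hypothesis A_ad : almost_disjoint A.
Implicit Types f g : K_space A -> R^o.

(* f - f(oo) is a uniform limit of combinations of the indicators of the clopen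
   sets {X} `|` X and of functions finitely supported in N. *)
Definition approximable f : Prop := forall e : R, 0 < e ->
  exists (E : seq A) (H : set N), [/\ uniq E, finite_set H,
    forall n, ~ H n -> `|f (Kpoint n) - f Kinfty -
      \sum_(X <- E) (f (Kset X) - f Kinfty) * (n \in val X)%:R| < e &
    forall X, X \notin E -> `|f (Kset X) - f Kinfty| < e].

Lemma sum_indicator (h : A -> R) (E : seq A) (X : A) n :
  uniq E -> X \in E -> n \in val X ->
  (forall Y, Y \in E -> val Y n -> X = Y) ->
  \sum_(Y <- E) h Y * (n \in val Y)%:R = h X.
Proof.
move=> uE XE Xn XY; rewrite (bigD1_seq X)//= Xn mulr1 big_seq_cond big1 ?addr0//.
move=> Y /andP[YE /eqP YX].
have [/set_mem Yn|_] := boolP (n \in val Y); last by rewrite mulr0.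
by case: YX; rewrite (XY Y).
Qed.

Lemma sum_indicator0 (h : A -> R) (E : seq A) n :
  (forall Y, Y \in E -> ~ val Y n) ->
  \sum_(Y <- E) h Y * (n \in val Y)%:R = 0.
Proof.
move=> nE; rewrite big_seq big1// => Y YE.
by rewrite memNset ?mulr0//; exact: nE.
Qed.

Lemma finite_far f X e : continuous f -> 0 < e ->
  finite_set [set n | val X n /\ e <= `|f (Kpoint n) - f (Kset X)|].
Proof.
move=> cf e0; have /cvgrPdist_lt/(_ e e0) := cf (Kset X).
case=> F finF FP; apply: sub_finite_set finF => n [Xn].
rewrite leNgt => /negP far; apply: contrapT => Fn; apply: far.
by rewrite distrC; apply: (FP (inl n)); right; exists n.
Qed.

(** By compactness, finitely many isolated points and sequences cover the space together with the
    set where f is near its value at infinity; the sequences used form [E]. *)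
Lemma continuous_approximable f : continuous f -> approximable f.
Proof.
move=> cf e e0.
pose V (x : K_space A) : set (K_space A) := match x with
  | None => [set y | `|f y - f Kinfty| < e]
  | Some (inl n) => [set Kpoint n]
  | Some (inr X) => [set Some y | y in psi_sequence X]
  end.
have openV x : [set: K_space A] x -> open (V x).
  move=> _; case: x => [[n|X]|]/=.
  - by rewrite openE => _ ->; exact/principal_filterP.
  - apply: one_point_compactification_open_some; rewrite openE => y yX.
    case: y yX => [n Xn|Y XY]; first exact/principal_filterP.
    case: XY => [[->]|[n _ //]].
    exists set0 => [|y]; first exact: finite_set0.
    by move=> [->|[n [Xn _] <-]]; [left|right; exists n].
  - rewrite (_ : [set y | _] = f @^-1` ball (f Kinfty) e).
      by move/continuousP: cf; apply; exact: ball_open.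
    by apply/seteqP; split=> y /=; rewrite /ball/= distrC.
have : compact [set: K_space A] by exact: one_point_compactification_compact.
rewrite compact_cover => /(_ _ _ _ openV)[].
  by move=> [[n|X]|] _; [exists (Kpoint n)|exists (Kset X) => //|exists Kinfty];
    rewrite //= ?subrr ?normr0//; exists (inr X) => //; left.
move=> D _ DV; pose E := undup (pmap (fun x : K_space A =>
  if x is Some (inr X) then Some X else None) D).
have DE X : Kset X \in D -> X \in E.
  by move=> XD; rewrite mem_undup mem_pmap; apply/mapP; exists (Kset X).
(* Outside this finite set, [n] either lies in exactly one [X] of [E] and f is near its value at
   [X], or lies in none and is covered only by the neighbourhood of infinity. *)
exists E, ([set n | Kpoint n \in D] `|` (\bigcup_(X in [set` E])
  ([set n | val X n /\ exists Y, [/\ Y \in E, X <> Y & val Y n]] `|`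
   [set n | val X n /\ e <= `|f (Kpoint n) - f (Kset X)|]))); split.
- exact: undup_uniq.
- rewrite finite_setU; split.
    apply: (@sub_finite_set _ _ (Kpoint @^-1` [set` D])) => //.
    by apply: finite_preimage => // x y _ _ [].
  apply: bigcup_finite => [|X _]; first exact: finite_seq.
  by rewrite finite_setU; split; [exact: finite_overlap|exact: finite_far].
- move=> n /not_orP[nD nE].
  have [[X XE Xn]|nX] := pselect (exists2 X, X \in E & val X n).
    rewrite (@sum_indicator _ _ X)//.
    + rewrite opprB addrA subrK ltNge; apply/negP => far; apply: nE.
      by exists X => //; right.
    + exact: undup_uniq.
    + exact/mem_set.
    + move=> Y YE Yn; apply: contrapT => XY; apply: nE.
      by exists X => //; left; split => //; exists Y.
  rewrite sum_indicator0 ?subr0; last by move=> Y YE Yn; apply: nX; exists Y.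
  have [[[m|X]|]/= xD] := DV (Kpoint n) Logic.I; last by [].
    by move=> [nm]; case: nD; rewrite /= /Kpoint nm.
  by case=> y [->//|[m Xm <-]] [mn]; case: nX; exists X; [exact: DE|rewrite -mn].
- move=> X XE; have [[[m|Y]|]/= xD] := DV (Kset X) Logic.I; [by []| |by []].
  case=> y [->|[m _ <-]]// [YX]; case/negP: XE; rewrite -YX; exact: DE.
Qed.

(** Close to [X] the sum reduces to one term if [X] is in [E] and to zero otherwise; close to
    infinity it is zero. *)
Lemma approximable_continuous f : approximable f -> continuous f.
Proof.
move=> af x; apply/(@cvgrPdist_lt _ _ _ (nbhs x)) => e e0.
have e20 : 0 < e / 2 by rewrite divr_gt0.
have [E [H [uE finH HP EP]]] := af (e / 2) e20.
case: x => [[n|X]|].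
- by apply/principal_filterP; rewrite /= subrr normr0.
- exists (H `|` [set n | val X n /\ exists Y, [/\ Y \in E, X <> Y & val Y n]]).
    by rewrite /= finite_setU; split => //; exact: finite_overlap.
  move=> _ [->/=|[n [Xn /not_orP[Hn nE]] <-]]; first by rewrite subrr normr0.
  have XY Y : Y \in E -> val Y n -> X = Y.
    move=> YE Yn; apply: contrapT => XY; apply: nE; split => //; by exists Y.
  have := HP n Hn; have [XE|XE] := boolP (X \in E).
    rewrite (sum_indicator _ uE XE)//; last exact/mem_set.
    by rewrite opprB addrA subrK distrC => /lt_trans; apply; lra.
  rewrite sum_indicator0 ?subr0 => [|Y YE Yn]; last first.
    by move: XE; rewrite (XY Y YE Yn) YE.
  have := EP X XE; rewrite /Kset /Kpoint /= => h1 h2.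
  rewrite [e]splitr -[X in `|X|](subrKA (f Kinfty)).
  by rewrite (le_lt_trans (ler_normD _ _))// ltrD// distrC.
- exists (psi_compact E H).
    by split; [exact: compact_psi_compact|exact: closed_psi_compact].
  move=> _ [[[n|X]] nW <-|->]; last by rewrite /= subrr normr0.
  + move: nW => /not_orP[Hn nE]; have := HP n Hn.
    rewrite sum_indicator0 ?subr0 => [|Y YE Yn]; last by apply: nE; exists Y.
    by rewrite distrC => /lt_trans; apply; lra.
  + by have /negP/EP := nW; rewrite distrC => /lt_trans; apply; lra.
Qed.

Lemma approximableP f : continuous f <-> approximable f.
Proof.
by split; [exact: continuous_approximable|exact: approximable_continuous].
Qed.

(** Membership in c_0(N), phrased by finiteness because [N] comes without an enumeration. *)
Definition vanishing (u : N -> R) : Prop :=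
  forall e, 0 < e -> finite_set [set n | e <= `|u n|].

Definition extend0 (u : N -> R) : K_space A -> R^o :=
  fun x => if x is Some (inl n) then u n else 0.

Lemma continuous_extend0 u : vanishing u -> continuous (extend0 u).
Proof.
move=> u0; apply/approximableP => e e0; exists [::], [set n | e <= `|u n|].
split=> [//||n /negP|X _]; first exact: u0.
  by rewrite big_nil !subr0 -ltNge.
by rewrite subrr normr0.
Qed.

(** With [continuous_extend0], this identifies the kernel of the restriction to the family and
    infinity with c_0(N). *)
Lemma vanishing_continuous f : continuous f -> f Kinfty = 0 ->
  (forall X, f (Kset X) = 0) -> vanishing (f \o Kpoint).
Proof.
move=> /approximableP af f0 fX e /af[E [H [uE finH HP _]]].
apply: sub_finite_set finH => n /=; apply: contraPP => /HP.
rewrite f0 big1 ?subr0 => [|X _]; last by rewrite fX subrr mul0r.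
by rewrite ltNge => /negP.
Qed.

End approximation.

(** * The lifting operator *)

Section pull.
Context {R : realType} {N M : choiceType} {A : set (set N)} {B : set (set M)}.
Context {e : A -> B} {e' : B -> A} {nu : N -> seq M} {C : nat}.
Hypotheses (A_ad : almost_disjoint A) (B_ad : almost_disjoint B)
  (eK : cancel e e') (e'K : cancel e' e)
  (nuC : forall n, (size (nu n) <= C)%N)
  (nu_fin : forall m, finite_set [set n | m \in nu n])
  (nu_count : forall X, finite_set
    [set n | count (fun m => m \in val (e X)) (nu n) != (n \in val X) :> nat]).

Definition pull (e : A -> B) (nu : N -> seq M) (f : K_space B -> R^o) :
    K_space A -> R^o := fun x =>
  match x with
  | Some (inl n) => f Kinfty + \sum_(m <- nu n) (f (Kpoint m) - f Kinfty)
  | Some (inr X) => f (Kset (e X))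
  | None => f Kinfty
  end.

Lemma pull_linear a f g :
  pull e nu (a *: f + g) = a *: pull e nu f + pull e nu g.
Proof.
apply/funext => -[[n|X]|] //=; rewrite !fctE/=.
rewrite scalerDr addrACA; congr (_ + _); rewrite scaler_sumr -big_split/=.
by apply: eq_bigr => m _; rewrite scalerBr opprD addrACA.
Qed.

(** The value at infinity contributes [a], and each of the at most [C] differences contributes
    [2 * a]. *)
Lemma pull_bounded f a : (forall x, `|f x| <= a) ->
  forall x, `|pull e nu f x| <= (1 + 2 * C%:R) * a.
Proof.
move=> fa; have a0 : 0 <= a := le_trans (normr_ge0 _) (fa Kinfty).
have le_a : a <= (1 + 2 * C%:R) * a.
  by rewrite mulrDl mul1r lerDl !mulr_ge0.
move=> [[n|X]|]; do 2?[exact: le_trans (fa _) le_a].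
rewrite mulrDl mul1r (le_trans (ler_normD _ _))// lerD//.
rewrite (le_trans (ler_norm_sum _ _ _))//.
apply: (@le_trans _ _ (\sum_(m <- nu n) (2 * a))).
  apply: ler_sum => m _; rewrite (le_trans (ler_normB _ _))//.
  by rewrite mulr2n mulrDl mul1r lerD.
rewrite big_const_seq count_predT iter_addr_0 -[_ *+ _]mulr_natl mulrA.
by rewrite [2 * _]mulrC -!mulrA ler_wpM2r ?mulr_ge0// ler_nat.
Qed.

(** Where the counts are right, pulling back turns the indicator of [Y] into that of [e' Y], with
    the same coefficient. *)
Lemma sum_indicator_pull (f : K_space B -> R^o) (E : seq B) n :
  (forall Y, Y \in E ->
    count (fun m => m \in val Y) (nu n) = (n \in val (e' Y)) :> nat) ->
  \sum_(X <- map e' E) (f (Kset (e X)) - f Kinfty) * (n \in val X)%:R =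
  \sum_(m <- nu n) \sum_(Y <- E) (f (Kset Y) - f Kinfty) * (m \in val Y)%:R.
Proof.
move=> Ecount; rewrite big_map exchange_big/= big_seq [RHS]big_seq.
apply: eq_bigr => Y /Ecount YE; rewrite e'K -mulr_sumr; congr (_ * _).
rewrite -YE -sum1_count natr_sum big_mkcond/=.
by apply: eq_bigr => m _; case: (m \in _).
Qed.

Lemma pull_continuous f : continuous f -> continuous (pull e nu f).
Proof.
move=> /(approximableP B_ad) af; apply/(approximableP A_ad) => d d0.
(* At most [C] errors add up at a point; [C.+1] is positive and leaves the total strictly below
   [d]. *)
have dC0 : 0 < d / C.+1%:R by rewrite divr_gt0.
have [E [H [uE finH HP EP]]] := af _ dC0.
(* The excluded points are those whose list meets [H] or has a wrong count for some [Y] in [E]. *)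
exists (map e' E), (\bigcup_(m in H) [set n | m \in nu n] `|`
  \bigcup_(Y in [set` E])
    [set n | count (fun m => m \in val Y) (nu n) != (n \in val (e' Y)) :> nat]).
have dCd : d / C.+1%:R <= d.
  by rewrite ler_pdivrMr//; apply: ler_peMr; rewrite ?ler1n// ltW.
split.
- by rewrite map_inj_uniq//; exact: can_inj e'K.
- rewrite finite_setU; split; first by apply: bigcup_finite.
  apply: bigcup_finite => [|Y _]; first exact: finite_seq.
  by have := nu_count (e' Y); rewrite e'K.
- move=> n /not_orP[nH nE] /=.
  rewrite (addrC (f Kinfty)) addrK sum_indicator_pull.
    rewrite -sumrB (le_lt_trans (ler_norm_sum _ _ _))//.
    apply: (@le_lt_trans _ _ (\sum_(m <- nu n) (d / C.+1%:R))).
      rewrite big_seq [leRHS]big_seq; apply: ler_sum => m mn.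
      by apply/ltW/HP => Hm; apply: nH; exists m.
    rewrite big_const_seq count_predT iter_addr_0 -[_ *+ _]mulr_natl mulrCA.
    by rewrite gtr_pMr// ltr_pdivrMr// mul1r ltr_nat ltnS.
  by move=> Y YE; apply/eqP; apply: contrapT => /negP h; apply: nE; exists Y.
- move=> X XE /=; apply: lt_le_trans dCd; apply: EP.
  by apply: contra XE => /(map_f e'); rewrite eK.
Qed.

End pull.

(** * Absorbing a copy of c_0 *)

(* A sequence D converging to [limit] is identified with D plus a disjoint copy
   of M, so that c_0(D) absorbs c_0(M). *)
Record splitting (R : realType) (N M : choiceType) (A : set (set N)) := {
  limit : K_space A;
  base : set N;
  merge : N + M -> N;
  unmerge : N -> N + M;
  limit_not_point : forall n, limit <> Kpoint n;
  mergeK : cancel merge unmerge;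
  unmergeK : cancel unmerge merge;
  merge_inl : forall n, ~ base n -> merge (inl n) = n;
  merge_base_inl : forall n, base n -> base (merge (inl n));
  merge_base_inr : forall m, base (merge (inr m));
  base_cvg : forall (f : K_space A -> R^o) (e : R), continuous f -> 0 < e ->
    finite_set [set n | base n /\ e <= `|f (Kpoint n) - f limit|] }.

Lemma exists_merge (N M : countType) (D : set N) : infinite_set D ->
  exists (h : N + M -> N) (h' : N -> N + M),
    [/\ cancel h h', cancel h' h, forall n, ~ D n -> h (inl n) = n,
        forall n, D n -> D (h (inl n)) & forall m, D (h (inr m))].
Proof.
move=> infD; have [n0 _] := infinite_setN0 infD.
pose NP : pointedType := HB.pack N (isPointed.Build N n0).
pose S : set (N + M) := [set x | if x is inl n then D n else True].
have /(@card_set_bijP _ NP)[k [kfun kinj ksurj]] : S #= D.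
  apply: card_eq_trans (_ : _ #= [set: nat]) _.
    apply: eq_card_nat; first exact: countableP.
    apply: contra_not infD => finS.
    apply: (sub_finite_set (B := inl @^-1` S)) => //.
    by apply: finite_preimage => // ? ? _ _ [].
  by rewrite card_eq_sym; apply: eq_card_nat => //; exact: countableP.
(* The value [n0] is never reached, since every [inr m] lies in [S]. *)
pose h x := if pselect (S x) then k x else if x is inl n then n else n0.
have hS x : S x -> h x = k x by rewrite /h; case: pselect.
have hN n : ~ D n -> h (inl n) = n by rewrite /h; case: pselect.
have NS x : ~ S x -> exists2 n, ~ D n & x = inl n.
  by case: x => [n Dn|m []//]; exists n.
have [h' hK h'K] : bijective h.
  rewrite -setTT_bijective; split => // [x y _ _|n _].
  - have [Sx|/NS[n Dn ->]] := pselect (S x);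
      have [Sy|/NS[m Dm ->]] := pselect (S y).
    + by rewrite !hS//; apply: kinj; exact/mem_set.
    + by rewrite hS// hN// => xm; case: Dm; rewrite -xm; exact: kfun.
    + by rewrite hN// hS// => xm; case: Dn; rewrite xm; exact: kfun.
    + by rewrite !hN// => ->.
  - have [/ksurj[x Sx <-]|Dn] := pselect (D n).
      by exists x => //; exact: hS.
    by exists (inl n) => //; exact: hN.
by exists h, h'; split => // [n Dn|m]; rewrite hS//; exact: kfun.
Qed.

Lemma exists_splitting (R : realType) (N M : countType) (A : set (set N)) :
  infinite_set [set: N] -> almost_disjoint A -> inhabited (splitting R M A).
Proof.
move=> infN A_ad.
suff [x [D [xN infD Dx]]] : exists (x : K_space A) (D : set N),
    [/\ forall n, x <> Kpoint n, infinite_set D &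
      forall (f : K_space A -> R^o) (e : R), continuous f -> 0 < e ->
        finite_set [set n | D n /\ e <= `|f (Kpoint n) - f x|]].
  have [h [h' [hK h'K h1 h2 h3]]] := exists_merge M infD.
  exact: inhabits (Build_splitting xN hK h'K h1 h2 h3 Dx).
(* A member of the family is itself a sequence converging to the corresponding point; if there is
   none, all of [N] converges to infinity. *)
have [[X AX]|A0] := pselect (A !=set0).
  exists (Kset (exist _ X (mem_set AX))), X; split => //; first exact: A_ad.1.
  by move=> f e cf e0; exact: (finite_far (exist _ X (mem_set AX)) cf e0).
exists Kinfty, setT; split => // f e /(approximableP A_ad) af.
move=> /af[E [H [_ finH HP _]]].
apply: sub_finite_set finH => n [_]; apply: contraPP => /HP.
rewrite sum_indicator0 ?subr0 => [|Y]; last first.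
  by case: A0; exists (val Y); exact: set_valP.
by rewrite ltNge => /negP.
Qed.

Section split_join.
Context {R : realType} {N M : choiceType} {A : set (set N)}
  (S : splitting R M A).
Hypothesis A_ad : almost_disjoint A.
Implicit Types (f g : K_space A -> R^o) (u v : M -> R^o).

(** With inverse [join], an isomorphism of C(K_A) onto C(K_A) + c_0(M) that leaves the values on the
    family and at infinity unchanged. *)
Definition split f : (K_space A -> R^o) * (M -> R^o) :=
  (fun x => if x is Some (inl n) then f (Kpoint (merge S (inl n))) else f x,
   fun m => f (Kpoint (merge S (inr m))) - f (limit S)).

Definition join (p : (K_space A -> R^o) * (M -> R^o)) : K_space A -> R^o :=
  fun x => if x is Some (inl n) then
      match unmerge S n with
      | inl n' => p.1 (Kpoint n')
      | inr m => p.1 (limit S) + p.2 m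
      end
    else p.1 x.

Lemma splitK : cancel split join.
Proof.
move=> f; apply/funext => -[[n|X]|]//=; rewrite -[in RHS](unmergeK S n).
case: (unmerge S n) => [//|m].
case: (limit S) (@limit_not_point _ _ _ _ S) => [[k|X]|] /=;
  by [move/(_ k)|rewrite addrC subrK].
Qed.

Lemma joinK : cancel join split.
Proof.
move=> [f u]; congr (_, _); apply/funext.
  by move=> [[n|X]|]//=; rewrite mergeK.
move=> m /=; rewrite mergeK.
by case: (limit S) (@limit_not_point _ _ _ _ S) => [[k|X]|] /= h;
  [case: (h k)|rewrite addrC addKr..].
Qed.

Lemma split_linear a f g : split (a *: f + g) = a *: split f + split g.
Proof.
congr (_, _); apply/funext; first by move=> [[n|X]|].
by move=> m /=; rewrite !fctE/= scalerBr opprD addrACA.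
Qed.

Lemma join_linear a p q : join (a *: p + q) = a *: join p + join q.
Proof.
apply/funext => -[[n|X]|]//=; rewrite !fctE/=; case: (unmerge S n) => //= m.
by rewrite scalerDr addrACA.
Qed.

Lemma split_continuous f : continuous f ->
  continuous (split f).1 /\ vanishing (split f).2.
Proof.
move=> cf; split; last first.
  move=> e e0; apply: (@sub_finite_set _ _ ((merge S \o inr) @^-1`
      [set n | base S n /\ e <= `|f (Kpoint n) - f (limit S)|])).
    by move=> m em; split => //; exact: merge_base_inr.
  apply: finite_preimage; last exact: base_cvg.
  by move=> x y _ _ /(can_inj (@mergeK _ _ _ _ S))[].
(* The correction [u] is zero off the base; on it, it compares two values that are both close to the
   value at the limit outside a finite set. *)
pose u n : R := f (Kpoint (merge S (inl n))) - f (Kpoint n).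
have -> : (split f).1 = 1 *: f + extend0 u.
  by apply/funext => -[[n|X]|]/=; rewrite !fctE/= scale1r ?addr0// addrC subrK.
apply: continuousZD => //; apply: continuous_extend0 => // e e0.
pose far := [set n | base S n /\ e / 2 <= `|f (Kpoint n) - f (limit S)|].
have fin : finite_set far by apply: base_cvg => //; rewrite divr_gt0.
apply: (@sub_finite_set _ _ (far `|` (merge S \o inl) @^-1` far)); last first.
  rewrite finite_setU; split => //; apply: finite_preimage => //.
  by move=> x y _ _ /(can_inj (@mergeK _ _ _ _ S))[].
move=> n; rewrite /u /=; have [Dn|Dn] := pselect (base S n); last first.
  by rewrite merge_inl// subrr normr0 leNgt e0.
move=> en; rewrite /far /=; apply: contrapT => /not_orP[h1 h2].
have {}h1 : `|f (Kpoint n) - f (limit S)| < e / 2.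
  by rewrite ltNge; apply/negP => h; apply: h1.
have {}h2 : `|f (Kpoint (merge S (inl n))) - f (limit S)| < e / 2.
  rewrite ltNge; apply/negP => h; apply: h2.
  by split => //; exact: merge_base_inl.
move: en; rewrite leNgt => /negP; apply.
rewrite -(subrKA (f (limit S))) [e]splitr (le_lt_trans (ler_normD _ _))//.
by rewrite ltrD// distrC.
Qed.

Lemma join_continuous p :
  continuous p.1 -> vanishing p.2 -> continuous (join p).
Proof.
case: p => f u /= cf u0; pose w n : R := join (f, u) (Kpoint n) - f (Kpoint n).
have -> : join (f, u) = 1 *: f + extend0 w.
  by apply/funext => -[[n|X]|]/=; rewrite !fctE/= scale1r ?addr0// addrC subrK.
apply: continuousZD => //; apply: continuous_extend0 => // e e0.
pose far := [set n | base S n /\ e / 2 <= `|f (Kpoint n) - f (limit S)|].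
have e20 : 0 < e / 2 by rewrite divr_gt0.
have fin : finite_set far by exact: base_cvg.
apply: (@sub_finite_set _ _ (far `|` ((merge S \o inl) @` far `|`
    (merge S \o inr) @` [set m | e / 2 <= `|u m|]))); last first.
  rewrite !finite_setU; do 2?split => //; apply: finite_image => //.
  exact: u0.
move=> n; rewrite /w /=; have [Dn|Dn] := pselect (base S n); last first.
  have -> : unmerge S n = inl n by rewrite -{1}(merge_inl Dn) mergeK.
  by rewrite subrr normr0 leNgt e0.
move=> en; apply: contrapT => /not_orP[h1 /not_orP[h2 h3]].
have {}h1 : `|f (limit S) - f (Kpoint n)| < e / 2.
  by rewrite distrC ltNge; apply/negP => h; apply: h1.
move: en; rewrite leNgt => /negP; apply; rewrite -(subrKA (f (limit S))).
rewrite [e]splitr (le_lt_trans (ler_normD _ _))// ltrD//.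
have := unmergeK S n; case: (unmerge S n) => [n'|m] nE.
  rewrite ltNge; apply/negP => h; apply: h2; exists n' => //; split => //.
  (* Off the base, [n'] would be fixed by the merge and so equal [n], which lies in the base. *)
  by apply: contrapT => Dn'; move: (Dn'); rewrite -(merge_inl Dn') nE.
by rewrite addrC addKr ltNge; apply/negP => h; apply: h3; exists m.
Qed.

Lemma split_bounded f a : (forall x, `|f x| <= a) ->
  (forall x, `|(split f).1 x| <= a) /\ (forall m, `|(split f).2 m| <= 2 * a).
Proof.
move=> fa; split=> [[[n|X]|]|m] //=.
by rewrite (le_trans (ler_normB _ _))// mulr_natl mulr2n lerD.
Qed.

Lemma join_bounded p a b :
  (forall x, `|p.1 x| <= a) -> (forall m, `|p.2 m| <= b) ->
  0 <= b -> forall x, `|join p x| <= a + b.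
Proof.
move=> pa pb b0; have pab x : `|p.1 x| <= a + b.
  by rewrite (le_trans (pa x))// lerDl.
move=> [[n|X]|] //=; case: (unmerge S n) => //= m.
by rewrite (le_trans (ler_normD _ _))// lerD.
Qed.

End split_join.

(** * The isomorphism *)

(** Operators act on all functions, which avoids subtypes. Boundedness refers to any pointwise
    bound, because [sup_norm] is meaningful only for bounded functions. *)
Definition lifting (R : realType) (N M : choiceType) (A : set (set N))
    (B : set (set M)) (e : B -> A)
    (U : (K_space A -> R^o) -> (K_space B -> R^o)) : Prop :=
  [/\ forall a f g, U (a *: f + g) = a *: U f + U g,
      forall f, continuous f -> continuous (U f),
      exists2 k, 0 <= k &
        forall f a, (forall x, `|f x| <= a) -> forall y, `|U f y| <= k * a,
      forall f Y, U f (Kset Y) = f (Kset (e Y)) &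
      forall f, U f Kinfty = f Kinfty].

Section exchange.
Context {R : realType} {N M : choiceType} {A : set (set N)} {B : set (set M)}.

(* In the second component, f - V g vanishes on A and at infinity when U and V
   preserve the values there. *)
Definition exchange (U : (K_space A -> R^o) -> (K_space B -> R^o))
    (V : (K_space B -> R^o) -> (K_space A -> R^o))
    (p : (K_space A -> R^o) * (M -> R^o)) : (K_space B -> R^o) * (N -> R^o) :=
  let g : K_space B -> R^o := U p.1 + extend0 p.2 in
  (g, fun n => p.1 (Kpoint n) - V g (Kpoint n)).

End exchange.

Section exchange_theory.
Context {R : realType} {N M : choiceType} {A : set (set N)} {B : set (set M)}.
Context {e : A -> B} {e' : B -> A}
  {U : (K_space A -> R^o) -> (K_space B -> R^o)}
  {V : (K_space B -> R^o) -> (K_space A -> R^o)}.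
Hypotheses (A_ad : almost_disjoint A) (B_ad : almost_disjoint B)
  (eK : cancel e e') (liftU : lifting e' U) (liftV : lifting e V).

(** With g the first component, V g agrees with f on the family and at infinity, and the second
    component restores f on [N]; then u is recovered as g - U f. *)
Lemma exchangeK : cancel (exchange U V) (exchange V U).
Proof.
have [_ _ _ US UI] := liftU; have [_ _ _ VS VI] := liftV.
move=> [f u]; rewrite /exchange/=; set g := U f + extend0 u.
have -> : V g + extend0 (fun n => f (Kpoint n) - V g (Kpoint n)) = f.
  apply/funext => -[[n|X]|]; rewrite !fctE/=.
  - by rewrite addrC subrK.
  - by rewrite addr0 VS /g !fctE/= addr0 US eK.
  - by rewrite addr0 VI /g !fctE/= addr0 UI.
congr (_, _); apply/funext => m; rewrite /g !fctE/=.
by rewrite addrAC subrr add0r.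
Qed.

Lemma exchange_linear a p q :
  exchange U V (a *: p + q) = a *: exchange U V p + exchange U V q.
Proof.
have [Ulin _ _ _ _] := liftU; have [Vlin _ _ _ _] := liftV.
rewrite /exchange/=; set g1 := U p.1 + extend0 p.2.
set g2 := U q.1 + extend0 q.2.
have -> : U (a *: p.1 + q.1) + extend0 (a *: p.2 + q.2) = a *: g1 + g2.
  rewrite Ulin /g1 /g2 scalerDr addrACA; congr (_ + _).
  by apply/funext => -[[n|X]|]; rewrite !fctE/= ?scaler0 ?addr0.
congr (_, _); apply/funext => n; rewrite Vlin !fctE/=.
by rewrite scalerBr opprD addrACA.
Qed.

Lemma exchange_continuous p : continuous p.1 -> vanishing p.2 ->
  continuous (exchange U V p).1 /\ vanishing (exchange U V p).2.
Proof.
have [_ Ucont _ US UI] := liftU; have [_ Vcont _ VS VI] := liftV.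
move=> cp1 p20; have cg : continuous (exchange U V p).1.
  rewrite /= -[U p.1]scale1r; apply: continuousZD; first exact: Ucont.
  exact: continuous_extend0.
split => //; set g := (exchange U V p).1 in cg *.
have -> : (exchange U V p).2 = (-1 *: V g + p.1) \o Kpoint.
  by apply/funext => n; rewrite /= !fctE/= scaleN1r addrC.
apply: vanishing_continuous => //.
- by apply: continuousZD => //; exact: Vcont.
- by rewrite !fctE/= VI /g /exchange/= !fctE/= addr0 UI scaleN1r addNr.
- move=> X; rewrite !fctE/= VS /g /exchange/= !fctE/= addr0 US eK.
  by rewrite scaleN1r addNr.
Qed.

Lemma exchange_bounded : exists2 k, 0 <= k & forall p a,
  (forall x, `|p.1 x| <= a) -> (forall m, `|p.2 m| <= 2 * a) ->
  (forall y, `|(exchange U V p).1 y| <= k * a) /\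
  (forall n, `|(exchange U V p).2 n| <= k * a).
Proof.
have [_ _ [k k0 kP] _ _] := liftU; have [_ _ [l l0 lP] _ _] := liftV.
have k20 : 0 <= k + 2 by rewrite addr_ge0.
have lk0 : 0 <= 1 + l * (k + 2) by rewrite addr_ge0// mulr_ge0.
(* The summands bound the two components separately; [2 * a] is the bound that [split] gives for its
   second component. *)
exists ((k + 2) + (1 + l * (k + 2))); first exact: addr_ge0.
move=> p a pa pb; have a0 : 0 <= a := le_trans (normr_ge0 _) (pa Kinfty).
have ga y : `|(exchange U V p).1 y| <= (k + 2) * a.
  rewrite /exchange/= !fctE (le_trans (ler_normD _ _))// mulrDl lerD//.
    exact: kP.
  by case: y => [[n|X]|] /=; rewrite ?normr0 ?mulr_ge0.
split=> [y|n].
  by rewrite (le_trans (ga y))// [leRHS]mulrDl lerDl mulr_ge0.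
rewrite (@le_trans _ _ (a + l * ((k + 2) * a)))//.
  by rewrite (le_trans (ler_normB _ _))// lerD//; exact: lP.
by rewrite mulrA -[X in X + _]mul1r -mulrDl [leRHS]mulrDl lerDr mulr_ge0.
Qed.

End exchange_theory.

Section equivalence.
Context {R : realType} {N M : choiceType} {A : set (set N)} {B : set (set M)}.
Context {e : A -> B} {e' : B -> A}
  {U : (K_space A -> R^o) -> (K_space B -> R^o)}
  {V : (K_space B -> R^o) -> (K_space A -> R^o)}
  (S : splitting R M A) (T : splitting R N B).
Hypotheses (A_ad : almost_disjoint A) (B_ad : almost_disjoint B)
  (eK : cancel e e') (liftU : lifting e' U) (liftV : lifting e V).

(** The composite C(K_A) = C(K_A) + c_0(M) = C(K_B) + c_0(N) = C(K_B) of isomorphisms. *)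
Definition equivalence (U : (K_space A -> R^o) -> (K_space B -> R^o))
    (V : (K_space B -> R^o) -> (K_space A -> R^o)) f :=
  join T (exchange U V (split S f)).

Lemma lifting_equivalence : lifting e' (equivalence U V).
Proof.
have [_ _ _ US UI] := liftU; rewrite /equivalence; split.
- by move=> a f g; rewrite split_linear (exchange_linear liftU liftV) join_linear.
- move=> f cf; have [cf1 cf2] := split_continuous S A_ad cf.
  have [cg1 cg2] := exchange_continuous A_ad B_ad eK liftU liftV cf1 cf2.
  exact: join_continuous.
- have [k k0 kP] := exchange_bounded liftU liftV.
  exists (k + k) => [|f a fa y]; first by rewrite addr_ge0.
  have [fa1 fa2] := split_bounded S fa; have [ga1 ga2] := kP _ _ fa1 fa2.
  rewrite mulrDl; apply: join_bounded => //.
  by rewrite mulr_ge0// (le_trans (normr_ge0 _) (fa Kinfty)).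
- by move=> f Y; rewrite /= !fctE/= addr0 US.
- by move=> f; rewrite /= !fctE/= addr0 UI.
Qed.

End equivalence.

Lemma equivalenceK (R : realType) (N M : choiceType) (A : set (set N))
    (B : set (set M)) (e : A -> B) (e' : B -> A)
    (U : (K_space A -> R^o) -> (K_space B -> R^o))
    (V : (K_space B -> R^o) -> (K_space A -> R^o))
    (S : splitting R M A) (T : splitting R N B) :
  cancel e e' -> lifting e' U -> lifting e V ->
  cancel (equivalence S T U V) (equivalence T S V U).
Proof.
move=> eK liftU liftV f.
by rewrite /equivalence joinK (exchangeK eK liftU liftV) splitK.
Qed.

(** * Passage from C(K) to JL_p *)

Section JL_map.
Context {R : realType} {N M : choiceType} {A : set (set N)} {B : set (set M)}.
Context (p : \bar R) (p1 : (1 < p)%E) {e : A -> B} {e' : B -> A}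
  {U : (K_space A -> R^o) -> (K_space B -> R^o)}.
Hypotheses (eK : cancel e e') (e'K : cancel e' e) (liftU : lifting e' U).

(** Only values on the family enter, and these are merely reindexed along [e']; hence one operator
    serves every exponent. *)
Lemma ell_norm_lifting r f : ell_norm r (U f) = ell_norm r f.
Proof.
have [_ _ _ US _] := liftU; rewrite /ell_norm; congr (_ `^ _)%E.
rewrite (@reindex_esum _ _ _ [set: B] [set: A] e'); last first.
  by rewrite setTT_bijective; exists e.
by apply: eq_esum => Y _; have := US f Y; rewrite /Kset => ->.
Qed.

Lemma in_JL_lifting f : in_JL p f -> in_JL p (U f).
Proof.
have [_ Ucont _ _ _] := liftU; move=> [cf fp]; split; first exact: Ucont.
by case: p fp => // r; rewrite ell_norm_lifting.
Qed.

Lemma JL_norm_lifting : exists2 k, 0 <= k &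
  forall f, continuous f -> JL_norm p (U f) <= k * JL_norm p f.
Proof.
(* [k + 1] dominates both [k], for the sup norm, and 1, for the preserved ell norm. *)
have [_ _ [k k0 kP] _ _] := liftU; exists (k + 1) => [|f cf].
  by rewrite addr_ge0.
have sU : sup_norm (U f) <= k * sup_norm f.
  by apply: sup_norm_le; apply: kP => x; exact: le_sup_norm.
have s0 := sup_norm_ge0 cf.
have sU' : sup_norm (U f) <= (k + 1) * sup_norm f.
  by rewrite (le_trans sU)// mulrDl mul1r lerDl.
have k10 : 0 <= k + 1 by rewrite addr_ge0.
rewrite /JL_norm; case: p => [r||]//.
rewrite ell_norm_lifting ge_max; apply/andP; split.
  by rewrite (le_trans sU')// ler_wpM2l// le_max lexx.
rewrite -[leLHS]mul1r ler_pM ?lerDr//; first by rewrite fine_ge0// ell_norm_ge0.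
by rewrite le_max lexx orbT.
Qed.

Lemma JL_lifting_subproof (f : JL A p1) : U (val f) \in @JL_pred R M B p.
Proof. by apply/asboolP/in_JL_lifting/asboolP/(valP f). Qed.

Definition JL_lifting (f : JL A p1) : JL B p1 :=
  exist (fun g => g \in @JL_pred R M B p) _ (JL_lifting_subproof f).

Lemma JL_lifting_linear : linear JL_lifting.
Proof.
by have [Ulin _ _ _ _] := liftU; move=> a f g; apply: val_inj; exact: Ulin.
Qed.

HB.instance Definition _ := GRing.isLinear.Build R (JL A p1) (JL B p1) _
  JL_lifting JL_lifting_linear.

Lemma JL_lifting_continuous : continuous JL_lifting.
Proof.
have [k k0 kP] := JL_norm_lifting.
apply: bounded_linear_continuous; apply/linear_boundedP; near=> r => f.
have /asboolP[cf _] := valP f.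
apply: (le_trans (kP _ cf)); apply: ler_wpM2r; first exact: (normr_ge0 f).
by near: r; apply: nbhs_pinfty_ge; exact: ger0_real.
Unshelve. all: by end_near. Qed.

End JL_map.

Lemma lifting_isomorphic (R : realType) (N M : choiceType) (A : set (set N))
    (B : set (set M)) (e : A -> B) (e' : B -> A)
    (U : (K_space A -> R^o) -> (K_space B -> R^o))
    (V : (K_space B -> R^o) -> (K_space A -> R^o))
    (p : \bar R) (p1 : (1 < p)%E) :
  cancel e e' -> cancel e' e -> lifting e' U -> lifting e V ->
  cancel U V -> cancel V U -> isomorphic (JL A p1) (JL B p1).
Proof.
move=> eK e'K liftU liftV UK VK.
exists (JL_lifting eK e'K liftU), (JL_lifting e'K eK liftV); split.
- by move=> f; apply: val_inj; exact: UK.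
- by move=> g; apply: val_inj; exact: VK.
- exact: JL_lifting_continuous.
- exact: JL_lifting_continuous.
Qed.

(** The lists given by Martin's axiom for the two families, indexed alike by [I], define the
    operator [pull]. *)
Lemma MA_lifting (R : realType) (I : Type) (N M : countType) (A : set (set N))
    (B : set (set M)) (a : I -> A) (a' : A -> I) (e : A -> B) (e' : B -> A) :
  MA_sigma_linked I -> almost_disjoint A -> almost_disjoint B ->
  cancel a a' -> cancel a' a -> cancel e e' -> cancel e' e ->
  exists V : (K_space B -> R^o) -> (K_space A -> R^o), lifting e V.
Proof.
move=> MA A_ad B_ad aK a'K eK e'K.
have [|||C [nu [nuC nu_fin nu_count]]] := @MA_transfer I N M
  (fun i => val (a i)) (fun i => val (e (a i))) MA.
- move=> x y xy; apply: A_ad.2; [exact: set_valP|exact: set_valP|].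
  by move/val_inj/(can_inj aK).
- by move=> x; apply: B_ad.1; exact: set_valP.
- move=> x y xy; apply: B_ad.2; [exact: set_valP|exact: set_valP|].
  by move/val_inj/(can_inj eK)/(can_inj aK).
exists (pull e nu); split.
- exact: pull_linear.
- apply: (pull_continuous A_ad B_ad eK e'K nuC nu_fin) => X.
  by have := nu_count (a' X); rewrite a'K.
- exists (1 + 2 * C%:R); first by rewrite addr_ge0// mulr_ge0.
  exact: pull_bounded.
- by [].
- by [].
Qed.

Theorem theorem6p4 (R : realType) (kappa : Type)
    (kappa_lt_continuum :
      [set: kappa] #<= [set: R] /\ ~ ([set: R] #<= [set: kappa]))
    (MA_kappa : MA_sigma_linked kappa)
    (N M : countType)
    (N_infinite : infinite_set [set: N]) (M_infinite : infinite_set [set: M])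
    (A : set (set N)) (B : set (set M))
    (A_ad : almost_disjoint A) (B_ad : almost_disjoint B)
    (A_kappa : A #= [set: kappa]) (B_kappa : B #= [set: kappa])
    (p : \bar R) (p_gt1 : (1 < p)%E) :
  isomorphic (JL A p_gt1) (JL B p_gt1).
Proof.
have [a' [a0 a'K0 aK0]] : exists f : A -> [set: kappa], bijective f.
  exact/card_bijP.
have [b' [b0 b'K0 bK0]] : exists f : B -> [set: kappa], bijective f.
  exact/card_bijP.
pose e := b0 \o a'; pose e' := a0 \o b'.
have eK : cancel e e' by move=> X; rewrite /e /e' /= bK0 a'K0.
have e'K : cancel e' e by move=> Y; rewrite /e /e' /= aK0 b'K0.
(* The bijections end in the subtype [[set: kappa]], whereas the axiom concerns [kappa] itself. *)
pose i (x : kappa) : [set: kappa] := exist _ x (mem_set Logic.I).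
have iK : cancel i val by [].
have Ki : cancel val i by move=> x; apply: val_inj.
have [V liftV] : exists V : (K_space B -> R^o) -> (K_space A -> R^o),
    lifting e V.
  exact: (@MA_lifting R kappa N M A B (a0 \o i) (val \o a') e e' MA_kappa A_ad
    B_ad (can_comp aK0 iK) (can_comp Ki a'K0) eK e'K).
have [U liftU] : exists U : (K_space A -> R^o) -> (K_space B -> R^o),
    lifting e' U.
  exact: (@MA_lifting R kappa M N B A (b0 \o i) (val \o b') e' e MA_kappa B_ad
    A_ad (can_comp bK0 iK) (can_comp Ki b'K0) e'K eK).
have [S] := @exists_splitting R N M A N_infinite A_ad.
have [T] := @exists_splitting R M N B M_infinite B_ad.
apply: (lifting_isomorphic p_gt1 eK e'K
  (lifting_equivalence S T A_ad B_ad eK liftU liftV)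
  (lifting_equivalence T S B_ad A_ad e'K liftV liftU)).
  exact: equivalenceK eK liftU liftV.
exact: equivalenceK e'K liftV liftU.
Qed.
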